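(* Let $G$ be a divisible abelian topological group (written additively) whose topology is generated by a sublinear group-norm $\|\cdot\|$ under which $G$ is complete. Then $G$ is a (real) topological vector space under the action given by $$t\cdot g:=\lim_{q\to t,\ q\in\mathbb{Q}_+} qg\qquad(t\in\mathbb{R}_+,\ g\in G)$$ (the limit existing in $G$), extended to $\mathbb{R}$ by $(-t)\cdot g:=t\cdot(-g)$. In particular, for each $g\in G$ the map $t\mapsto t\cdot g$ is a continuous additive map from $\mathbb{R}_+$ into $G$ (continuous embeddability).
   Context: A group-norm on a group $G$ is a map $\|\cdot\|:G\to[0,\infty)$ with $\|g\|=0$ iff $g$ is the identity, $\|g^{-1}\|=\|g\|$, and $\|gh\|\le\|g\|+\|h\|$; for abelian $G$ it induces the invariant metric $d(g,h)=\|g-h\|$. A group is divisible if for each $n\in\mathbb{N}$ each element $g$ has an $n$-th root, i.e. (additively) an $h$ with $nh=g$. On a divisible abelian group the group-norm is called *sublinear* if $\|ng\|=n\|g\|$ for all $g\in G$, $n\in\mathbb{N}$ (so that $G$ has no torsion, $qg$ is well defined for $q\in\mathbb{Q}_+$, and equivalently $\|qg\|=q\|g\|$ for $g\in G$, $q\in\mathbb{Q}_+$). *)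

(* Defs.v *)
From HB Require Import structures.
From mathcomp Require Import all_boot all_order all_algebra.
From mathcomp Require Import all_classical all_reals all_analysis.

Set Implicit Arguments.
Unset Strict Implicit.
Unset Printing Implicit Defensive.

Import Order.TTheory GRing.Theory Num.Theory.
Import numFieldNormedType.Exports.

Local Open Scope classical_set_scope.
Local Open Scope ring_scope.

Definition divisible_group (G : zmodType) : Prop :=
  forall (n : nat) (g : G), (0 < n)%N -> exists h : G, h *+ n = g.

Record group_norm (R : realType) (G : zmodType) (N : G -> R) : Prop := {
  group_norm_ge0 : forall g, 0 <= N g ;
  group_norm_eq0 : forall g, N g = 0 <-> g = 0 ;
  group_normN : forall g, N (- g) = N g ;
  group_normD : forall g h, N (g + h) <= N g + N h
}.

Definition sublinear_norm (R : realType) (G : zmodType) (N : G -> R) : Prop :=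
  forall (g : G) (n : nat), N (g *+ n) = n%:R * N g.

Definition norm_generates_topology (R : realType) (G : topologicalZmodType)
    (N : G -> R) : Prop :=
  forall g : G, nbhs g = nbhs_ball_ (ball_ N) g.

Definition norm_cauchy (R : realType) (G : zmodType) (N : G -> R)
    (u : nat -> G) : Prop :=
  forall e : R, 0 < e -> exists n0 : nat,
    forall m n : nat, (n0 <= m)%N -> (n0 <= n)%N -> N (u m - u n) < e.

(* Metric completeness, with convergence taken in the topology of G; it is
   only used together with norm_generates_topology. *)
Definition norm_complete (R : realType) (G : topologicalZmodType)
    (N : G -> R) : Prop :=
  forall u : nat -> G, norm_cauchy N u -> exists l : G, u @ \oo --> l.

(* For q = m / n >= 0 in lowest terms, q g is the h with n h = m g; this h
   exists and is unique when G is divisible and torsion-free. For q < 0 the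
   value is irrelevant: only nonnegative q are used below. *)
Definition rat_act (G : zmodType) (q : rat) (g : G) : G :=
  xget 0 [set h : G | h *+ `|denq q|%N = g *+ `|numq q|%N].

(* The filter "q -> t with q in Q_+": traces on the nonnegative rationals of
   the neighbourhoods of the real number t. *)
Definition near_Qplus (R : realType) (t : R) : set_system rat :=
  filter_from (nbhs t) (fun U => [set q : rat | 0 <= q /\ U (ratr q)]).

(* The limit of q g as q -> t in Q_+, for t >= 0 (0 if there is none). The
   library's lim is not available, as a topologicalZmodType is not pointed. *)
Definition rat_act_lim (R : realType) (G : topologicalZmodType)
    (t : R) (g : G) : G :=
  xget 0 [set l : G | (fun q : rat => rat_act q g) @ near_Qplus t --> l].

Definition real_act (R : realType) (G : topologicalZmodType)
    (t : R) (g : G) : G :=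
  if 0 <= t then rat_act_lim t g else rat_act_lim (- t) (- g).

(* The axioms added by Zmodule_isLmodule and by
   TopologicalZmodule_isTopologicalLmodule to those of a topologicalZmodType;
   topologicalLmodType_of_action below packs them accordingly. *)
Record tvs_action (R : realType) (G : topologicalZmodType)
    (act : R -> G -> G) : Prop := {
  tvs_actA : forall a b g, act a (act b g) = act (a * b) g ;
  tvs_act1 : left_id 1 act ;
  tvs_actDr : right_distributive act +%R ;
  tvs_actDl : forall g, {morph act^~ g : a b / a + b} ;
  tvs_act_continuous : continuous (fun z : R^o * G => act z.1 z.2)
}.

Definition topologicalLmodType_of_action (R : realType)
    (G : topologicalZmodType) (act : R -> G -> G) (H : tvs_action act) :
    topologicalLmodType R :=
  let L := GRing.Zmodule_isLmodule.Build R G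
    (tvs_actA H) (tvs_act1 H) (tvs_actDr H) (tvs_actDl H) in
  let V : lmodType R := HB.pack (TopologicalZmodule.sort G) L in
  let T := TopologicalZmodule_isTopologicalLmodule.Build R V
    (tvs_act_continuous H) in
  HB.pack (TopologicalZmodule.sort G) L T.

(* Main.v *)
(* Sublinearity makes G torsion-free, hence a Q-vector space in which
   N (p g - q g) = |p - q| N g for p, q >= 0. By completeness q g converges as
   q -> t, and the limit t g satisfies N (t g - q g) <= |t - q| N g for all
   q >= 0, which also determines it. The vector space axioms for t >= 0 then
   follow from those over Q+ by approximation, and for all reals by writing
   t = a - b with a, b >= 0. Joint continuity comes from N (t g) <= |t| N g. *)
Require Import Defs.
From HB Require Import structures.
From mathcomp Require Import all_boot all_order all_algebra.
From mathcomp Require Import all_classical all_reals all_analysis.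
From mathcomp Require Import ring lra.

Set Implicit Arguments.
Unset Strict Implicit.
Unset Printing Implicit Defensive.

Import Order.TTheory GRing.Theory Num.Theory.
Import numFieldNormedType.Exports.

Local Open Scope classical_set_scope.
Local Open Scope ring_scope.

(** * Approximation by nonnegative rationals *)

(** Lets later estimates carry any error of order [e], with no need to rescale [e] beforehand. *)
Lemma ler_addgt0_linear {R : realFieldType} (K x y : R) :
  (forall e, 0 < e -> x <= y + K * e) -> x <= y.
Proof.
move=> H; rewrite leNgt; apply/negP => yx.
have K1 : 0 < `|K| + 1 by rewrite ltr_wpDl.
(* The [+ 1] avoids division by zero; this [e] gives [K * e < x - y]. *)
have e0 : 0 < (x - y) / 2 / (`|K| + 1) by rewrite !divr_gt0 ?subr_gt0.
have := H _ e0; set e := _ / (_ + 1) in e0 *.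
have eE : `|K| * e + e = (x - y) / 2.
  by rewrite /e -[X in _ + X]mul1r -mulrDl mulrC divfK// gt_eqF.
have : K * e <= `|K| * e by rewrite ler_pM2r// ler_norm.
lra.
Qed.

Lemma exists_nonneg_rat_near {R : realType} (t e : R) : 0 <= t -> 0 < e ->
  exists q : rat, 0 <= q /\ `|t - ratr q| < e.
Proof.
(* Approximating [t] from above makes [q] nonnegative, even for [t = 0]. *)
move=> t0 e0; have /rat_in_itvoo[q] : t < t + e by rewrite ltrDl.
rewrite in_itv/= => /andP[tq qe]; exists q; split.
  by rewrite -(ler0q R) (le_trans t0)// ltW.
rewrite ltr_distlC; apply/andP; split=> //; lra.
Qed.

Lemma nonneg_rat_mul_denq (q : rat) : 0 <= q ->
  q * `|denq q|%:R = `|numq q|%:R.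
Proof.
move=> q0; rewrite natr_absz normr_denq natr_absz ger0_norm ?numq_ge0//.
by rewrite -{1}(divq_num_den q) divfK// intr_eq0 denq_eq0.
Qed.

Lemma nonneg_ratE (q : rat) : 0 <= q ->
  exists m n : nat, (0 < n)%N /\ q * n%:R = m%:R.
Proof.
move=> q0; exists `|numq q|%N, `|denq q|%N.
split; last exact: nonneg_rat_mul_denq.
by rewrite absz_gt0 denq_eq0.
Qed.

(** * The action of the nonnegative rationals *)

Section RationalAction.
Variables (R : realType) (G : zmodType) (N : G -> R).
Hypotheses (hdiv : divisible_group G) (hnorm : group_norm N).
Hypothesis hsub : sublinear_norm N.

(** Torsion-freeness: if [n g = n h], then [n N (g - h) = N (n (g - h)) = 0]. *)
Lemma sublinear_mulrnI n : (0 < n)%N -> injective (fun g : G => g *+ n).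
Proof.
move=> n0 g h /= gh; apply/eqP; rewrite -subr_eq0; apply/eqP.
apply/(group_norm_eq0 hnorm)/eqP.
have /eqP := hsub (g - h) n.
rewrite mulrnBl gh subrr (group_norm_eq0 hnorm 0).2// eq_sym mulf_eq0 pnatr_eq0.
by rewrite eqn0Ngt n0.
Qed.

Lemma group_norm0 : N 0 = 0.
Proof. exact/(group_norm_eq0 hnorm). Qed.

Lemma group_normB g h : N (g - h) <= N g + N h.
Proof. by rewrite -(group_normN hnorm h) group_normD. Qed.

Lemma group_norm_distC g h : N (g - h) = N (h - g).
Proof. by rewrite -opprB group_normN. Qed.

Lemma group_norm_dist_triangle g h k : N (h - k) <= N (h - g) + N (g - k).
Proof. by rewrite -(subrKA g h (- k)) group_normD. Qed.

(** The fraction [m / n] need not be in lowest terms: both sides agree after multiplication by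
    [denq q], which is injective. *)
Lemma rat_act_mulrn (q : rat) (g : G) (m n : nat) :
  (0 < n)%N -> 0 <= q -> q * n%:R = m%:R -> rat_act q g *+ n = g *+ m.
Proof.
move=> n0 q0 qnm; have d0 : (0 < `|denq q|)%N by rewrite absz_gt0 denq_eq0.
(* By divisibility the defining set is inhabited, so [xget] does not fall back on its default. *)
have /(xgetPex (0 : G))/= : exists h : G, h *+ `|denq q|%N = g *+ `|numq q|%N.
  exact: hdiv.
rewrite -/(rat_act q g) => qg.
have E : (n * `|numq q| = `|denq q| * m)%N.
  apply/eqP; rewrite -(eqr_nat rat) !natrM -nonneg_rat_mul_denq//.
  by apply/eqP; rewrite -qnm; ring.
apply: (sublinear_mulrnI d0) => /=.
by rewrite -mulrnA mulnC mulrnA qg -!mulrnA mulnC E mulnC.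
Qed.

(** Reduces the laws of the rational action to identities between integer multiples, by clearing
    denominators. *)
Lemma rat_act_unique (q : rat) (g h : G) (m n : nat) :
  (0 < n)%N -> 0 <= q -> q * n%:R = m%:R -> h *+ n = g *+ m -> rat_act q g = h.
Proof.
move=> n0 q0 qnm hg; apply: (sublinear_mulrnI n0) => /=.
by rewrite hg; exact: rat_act_mulrn.
Qed.

Lemma rat_act0 (g : G) : rat_act 0 g = 0.
Proof. by apply: (@rat_act_unique _ _ _ 0 1); rewrite ?mul0r ?mul0rn. Qed.

Lemma rat_act1 (g : G) : rat_act 1 g = g.
Proof. by apply: (@rat_act_unique _ _ _ 1 1). Qed.

Lemma rat_actDl (p q : rat) (g : G) : 0 <= p -> 0 <= q ->
  rat_act (p + q) g = rat_act p g + rat_act q g.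
Proof.
move=> p0 q0.
have [m [n [n0 pE]]] := nonneg_ratE p0; have [k [l [l0 qE]]] := nonneg_ratE q0.
apply: (@rat_act_unique _ _ _ (m * l + k * n) (n * l)).
- by rewrite muln_gt0 n0.
- exact: addr_ge0.
- by rewrite natrD !natrM -pE -qE; ring.
- rewrite mulrnDl mulrnA (rat_act_mulrn _ n0 p0 pE) mulnC mulrnA.
  by rewrite (rat_act_mulrn _ l0 q0 qE) mulrnDr -!mulrnA.
Qed.

Lemma rat_actDr (q : rat) (g h : G) : 0 <= q ->
  rat_act q (g + h) = rat_act q g + rat_act q h.
Proof.
move=> q0; have [m [n [n0 qE]]] := nonneg_ratE q0.
apply: (rat_act_unique n0 q0 qE).
by rewrite !mulrnDl !(rat_act_mulrn _ n0 q0 qE).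
Qed.

Lemma rat_actNr (q : rat) (g : G) : 0 <= q -> rat_act q (- g) = - rat_act q g.
Proof.
move=> q0; have [m [n [n0 qE]]] := nonneg_ratE q0.
apply: (rat_act_unique n0 q0 qE).
by rewrite !mulNrn (rat_act_mulrn _ n0 q0 qE).
Qed.

Lemma rat_actBr (q : rat) (g h : G) : 0 <= q ->
  rat_act q (g - h) = rat_act q g - rat_act q h.
Proof. by move=> q0; rewrite rat_actDr// rat_actNr. Qed.

Lemma rat_actA (p q : rat) (g : G) : 0 <= p -> 0 <= q ->
  rat_act p (rat_act q g) = rat_act (p * q) g.
Proof.
move=> p0 q0.
have [m [n [n0 pE]]] := nonneg_ratE p0; have [k [l [l0 qE]]] := nonneg_ratE q0.
apply/esym; apply: (@rat_act_unique _ _ _ (m * k) (n * l)).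
- by rewrite muln_gt0 n0.
- exact: mulr_ge0.
- by rewrite !natrM -pE -qE; ring.
- rewrite mulrnA (rat_act_mulrn _ n0 p0 pE) -mulrnA mulnC mulrnA.
  by rewrite (rat_act_mulrn _ l0 q0 qE) -mulrnA mulnC.
Qed.

Lemma norm_rat_act (q : rat) (g : G) : 0 <= q -> N (rat_act q g) = ratr q * N g.
Proof.
move=> q0; have [m [n [n0 qE]]] := nonneg_ratE q0.
have n0R : n%:R != 0 :> R by rewrite pnatr_eq0 -lt0n.
apply: (mulfI n0R); rewrite -hsub (rat_act_mulrn _ n0 q0 qE) hsub.
have qR : ratr q * n%:R = m%:R :> R.
  by rewrite -(ratr_nat R n) -rmorphM/= qE ratr_nat.
by rewrite mulrA [_ * ratr q]mulrC qR.
Qed.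

(** For [q <= p], additivity gives [p g - q g = (p - q) g], whose norm is known. The order is
    assumed first so that only nonnegative rationals act. *)
Lemma rat_act_dist (p q : rat) (g : G) : 0 <= p -> 0 <= q ->
  N (rat_act p g - rat_act q g) = `|ratr p - ratr q| * N g.
Proof.
wlog qp : p q / q <= p.
  move=> wlg p0 q0; have [/wlg->//|/ltW/wlg wlg'] := leP q p.
  by rewrite group_norm_distC distrC wlg'.
move=> p0 q0; have pq0 : 0 <= p - q by rewrite subr_ge0.
rewrite -{1}(subrK q p) rat_actDl// addrK norm_rat_act// rmorphB/= ger0_norm//.
by rewrite subr_ge0 ler_rat.
Qed.

End RationalAction.

(** * Existence and uniqueness of the limit of [q g] *)

Section RealAction.
Variables (R : realType) (G : topologicalZmodType) (N : G -> R).
Hypotheses (hdiv : divisible_group G) (hnorm : group_norm N).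
Hypotheses (hsub : sublinear_norm N) (htop : norm_generates_topology N).
Hypothesis hcomplete : norm_complete N.

Lemma nbhs_norm_ball (g : G) (e : R) : 0 < e -> nbhs g (ball_ N g e).
Proof. by rewrite htop => e0; exists e. Qed.

Lemma cvg_near_QplusP (t : R) (f : rat -> G) (l : G) :
  f @ near_Qplus t --> l <->
  forall e : R, 0 < e -> exists2 d : R, 0 < d &
    forall q : rat, 0 <= q -> `|t - ratr q| < d -> N (l - f q) < e.
Proof.
split=> [fl e e0|fl A].
  have [U tU UA] := fl _ (nbhs_norm_ball l e0).
  have /nbhs_ballP[d /= d0 dU] := tU.
  by exists d => // q q0 tq; apply: UA; split=> //; exact: dU.
rewrite htop => -[e /= e0 eA]; have [d d0 df] := fl e e0.
exists (ball t d); first exact: nbhsx_ballx.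
by move=> q [q0 tq]; apply: eA; exact: df.
Qed.

(* Since q |-> q g is (N g)-Lipschitz, l is the limit of q g at t as soon as l
   is approximated by q g for some rationals q close to t. *)
Lemma rat_act_approx_dist (t : R) (g l : G) (C : R) :
  (forall e : R, 0 < e -> exists q : rat,
    [/\ 0 <= q, `|t - ratr q| <= C * e & N (l - rat_act q g) <= C * e]) ->
  forall q : rat, 0 <= q -> N (l - rat_act q g) <= `|t - ratr q| * N g.
Proof.
(* Passing through [p g] costs [C e] for [l - p g] and [(C e + |t - q|) N g] for [p g - q g]. *)
move=> H q q0; apply: (@ler_addgt0_linear _ (C * (1 + N g))) => e e0.
have [p [p0 tp lp]] := H e e0.
have Ng := group_norm_ge0 hnorm g.
apply: (le_trans (group_norm_dist_triangle hnorm (rat_act p g) _ _)).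
rewrite (rat_act_dist hdiv hnorm hsub)//.
have : `|ratr p - ratr q| <= C * e + `|t - ratr q|.
  apply: (le_trans (ler_distD t _ _)); by rewrite distrC lerD2r.
move=> /(ler_wpM2r Ng); lra.
Qed.

Lemma rat_act_dist_cvg (t : R) (g l : G) :
  (forall q : rat, 0 <= q -> N (l - rat_act q g) <= `|t - ratr q| * N g) ->
  (fun q : rat => rat_act q g) @ near_Qplus t --> l.
Proof.
move=> H; apply/cvg_near_QplusP => e e0.
have Ng1 : 0 < N g + 1 by rewrite ltr_wpDl// (group_norm_ge0 hnorm).
exists (e / (N g + 1)); first exact: divr_gt0.
move=> q q0; rewrite ltr_pdivlMr// => tq; apply: le_lt_trans tq.
apply: (le_trans (H q q0)); apply: ler_wpM2l => //; lra.
Qed.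

Lemma rat_act_dist_unique (t : R) (g l l' : G) : 0 <= t ->
  (forall q : rat, 0 <= q -> N (l - rat_act q g) <= `|t - ratr q| * N g) ->
  (forall q : rat, 0 <= q -> N (l' - rat_act q g) <= `|t - ratr q| * N g) ->
  l = l'.
Proof.
move=> t0 H H'; apply/eqP; rewrite -subr_eq0; apply/eqP.
apply/(group_norm_eq0 hnorm)/le_anti.
rewrite (group_norm_ge0 hnorm) andbT.
apply: (@ler_addgt0_linear _ (2 * N g)) => e e0.
have [q [q0 tq]] := exists_nonneg_rat_near t0 e0.
apply: (le_trans (group_norm_dist_triangle hnorm (rat_act q g) _ _)).
rewrite [N (rat_act q g - l')](group_norm_distC hnorm).
have := ler_wpM2r (group_norm_ge0 hnorm g) (ltW tq).
have := H q q0; have := H' q q0; lra.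
Qed.

(** Turns convergence into an explicit bound, after which the filter can be forgotten. *)
Lemma rat_act_cvg_dist (t : R) (g l : G) : 0 <= t ->
  (fun q : rat => rat_act q g) @ near_Qplus t --> l ->
  forall q : rat, 0 <= q -> N (l - rat_act q g) <= `|t - ratr q| * N g.
Proof.
move=> t0 /cvg_near_QplusP H; apply: (@rat_act_approx_dist _ _ _ 1) => e e0.
have [d d0 dl] := H e e0.
(* Closeness [d] controls [N (l - q g)], closeness [e] controls [|t - q|]. *)
have ed0 : 0 < Num.min d e by rewrite lt_min d0.
have [q [q0]] := exists_nonneg_rat_near t0 ed0.
rewrite lt_min => /andP[qd qe].
by exists q; rewrite !mul1r q0 !ltW ?dl.
Qed.

(** Rationals [u n] tending to [t] give a Cauchy sequence [u n g]. Its limit exists by completeness,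
    and the Lipschitz bound makes it the limit along all nonnegative rationals. *)
Lemma rat_act_cvg_ex (t : R) (g : G) : 0 <= t ->
  exists l : G, (fun q : rat => rat_act q g) @ near_Qplus t --> l.
Proof.
move=> t0.
have /choice[u uP] (n : nat) : exists q : rat,
    0 <= q /\ `|t - ratr q| < n.+1%:R^-1.
  by apply: exists_nonneg_rat_near => //; rewrite invr_gt0.
have Ng := group_norm_ge0 hnorm g.
have uE (e : R) : 0 < e -> exists n0, forall n, (n0 <= n)%N ->
    `|t - ratr (u n)| <= e.
  move=> e0; have e0' : 0 <= e^-1 by rewrite invr_ge0 ltW.
  exists (Num.bound e^-1) => n hn; apply: (le_trans (ltW (uP n).2)).
  rewrite -[leRHS]invrK lef_pV2 ?posrE ?invr_gt0//.
  by rewrite (le_trans (ltW (archi_boundP e0')))// ler_nat ltnW.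
have /hcomplete[l ul] : norm_cauchy N (fun n => rat_act (u n) g).
  move=> e e0; have Ng1 : 0 < N g + 1 by lra.
  (* Two such errors, multiplied by [N g], stay below [e]. *)
  have e'0 : 0 < e / 2 / (N g + 1) by rewrite !divr_gt0.
  have e'E : e / 2 / (N g + 1) * (N g + 1) = e / 2 by rewrite divfK// gt_eqF.
  have [n0 n0P] := uE _ e'0; exists n0 => m n hm hn.
  rewrite (rat_act_dist hdiv hnorm hsub) ?(uP _).1//.
  have : `|ratr (u m) - ratr (u n)| <=
      e / 2 / (N g + 1) + e / 2 / (N g + 1).
    apply: (le_trans (ler_distD t _ _)).
    by rewrite lerD ?n0P// distrC n0P.
  move=> /(ler_wpM2r Ng); lra.
exists l; apply: rat_act_dist_cvg.
apply: (@rat_act_approx_dist _ _ _ 1) => e e0.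
have [n0 _ n0l] := ul _ (nbhs_norm_ball l e0); have [n1 n1P] := uE e e0.
exists (u (maxn n0 n1)); rewrite mul1r (uP _).1; split=> //.
  by apply: n1P; rewrite leq_maxr.
by apply/ltW/n0l; rewrite /= leq_maxl.
Qed.

(** * The action of the nonnegative reals *)

Lemma rat_act_lim_cvg (t : R) (g : G) : 0 <= t ->
  (fun q : rat => rat_act q g) @ near_Qplus t --> rat_act_lim t g.
Proof. by move=> t0; exact: (xgetPex (0 : G) (rat_act_cvg_ex g t0)). Qed.

Lemma rat_act_lim_dist (t : R) (g : G) (q : rat) : 0 <= t -> 0 <= q ->
  N (rat_act_lim t g - rat_act q g) <= `|t - ratr q| * N g.
Proof. by move=> t0; apply: rat_act_cvg_dist => //; exact: rat_act_lim_cvg. Qed.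

(** The tool for the algebraic laws: one rational per [e] suffices, and [C] may depend on [t], [g]
    and [l] but not on [e]. *)
Lemma rat_act_lim_unique (t : R) (g l : G) (C : R) : 0 <= t ->
  (forall e : R, 0 < e -> exists q : rat,
    [/\ 0 <= q, `|t - ratr q| <= C * e & N (l - rat_act q g) <= C * e]) ->
  rat_act_lim t g = l.
Proof.
move=> t0 H; apply: (rat_act_dist_unique t0) => q q0.
  exact: rat_act_lim_dist.
exact: (rat_act_approx_dist H).
Qed.

(** One [q] serves all [h] at once, as additivity in the vector requires. *)
Lemma rat_act_lim_near (t e : R) : 0 <= t -> 0 < e ->
  exists q : rat, [/\ 0 <= q, `|t - ratr q| <= e &
    forall h, N (rat_act_lim t h - rat_act q h) <= e * N h].
Proof.
move=> t0 e0; have [q [q0 /ltW tq]] := exists_nonneg_rat_near t0 e0.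
exists q; split=> // h; apply: (le_trans (rat_act_lim_dist h t0 q0)).
by rewrite ler_wpM2r// (group_norm_ge0 hnorm).
Qed.

Lemma norm_rat_act_lim (t : R) (g : G) : 0 <= t ->
  N (rat_act_lim t g) <= t * N g.
Proof.
move=> t0; have := rat_act_lim_dist g t0 (lexx 0).
by rewrite (rat_act0 hdiv hnorm hsub) rmorph0 !subr0 ger0_norm.
Qed.

Lemma rat_act_lim0 (g : G) : rat_act_lim (0 : R) g = 0.
Proof.
apply/(group_norm_eq0 hnorm)/le_anti; rewrite (group_norm_ge0 hnorm) andbT.
by rewrite (le_trans (norm_rat_act_lim _ _))// mul0r.
Qed.

Lemma rat_act_lim_ratr (q : rat) (g : G) : 0 <= q ->
  rat_act_lim (ratr q : R) g = rat_act q g.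
Proof.
move=> q0; apply: (@rat_act_lim_unique _ _ _ 1); first by rewrite ler0q.
move=> e /ltW e0; exists q.
by rewrite !subrr normr0 (group_norm0 hnorm) mul1r.
Qed.

Lemma rat_act_limDl (s t : R) (g : G) : 0 <= s -> 0 <= t ->
  rat_act_lim (s + t) g = rat_act_lim s g + rat_act_lim t g.
Proof.
(* The approximant is [p + q], with errors [2 e] in the scalar and [2 e N g] in the vector. *)
move=> s0 t0; apply: (@rat_act_lim_unique _ _ _ (2 * (N g + 1))).
  exact: addr_ge0.
move=> e e0; have Ng := mulr_ge0 (ltW e0) (group_norm_ge0 hnorm g).
have [p [p0 sp pg]] := rat_act_lim_near s0 e0.
have [q [q0 tq qg]] := rat_act_lim_near t0 e0.
exists (p + q); split; first exact: addr_ge0.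
  rewrite rmorphD/= opprD addrACA (le_trans (ler_normD _ _))//; lra.
rewrite (rat_actDl hdiv hnorm hsub)// opprD addrACA.
apply: (le_trans (group_normD hnorm _ _)).
have := pg g; have := qg g; lra.
Qed.

Lemma rat_act_limDr (t : R) (g h : G) : 0 <= t ->
  rat_act_lim t (g + h) = rat_act_lim t g + rat_act_lim t h.
Proof.
move=> t0; apply: (@rat_act_lim_unique _ _ _ (1 + N g + N h)) => // e e0.
have Ng := mulr_ge0 (ltW e0) (group_norm_ge0 hnorm g).
have Nh := mulr_ge0 (ltW e0) (group_norm_ge0 hnorm h).
have [q [q0 tq qP]] := rat_act_lim_near t0 e0.
exists q; split; [by []|lra|].
rewrite (rat_actDr hdiv hnorm hsub)// opprD addrACA.
apply: (le_trans (group_normD hnorm _ _)).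
have := qP g; have := qP h; lra.
Qed.

(** By additivity [t (- g) + t g = t 0], which vanishes by the norm bound. *)
Lemma rat_act_limNr (t : R) (g : G) : 0 <= t ->
  rat_act_lim t (- g) = - rat_act_lim t g.
Proof.
move=> t0; apply/eqP; rewrite -addr_eq0 -rat_act_limDr// addNr; apply/eqP.
apply/(group_norm_eq0 hnorm)/le_anti; rewrite (group_norm_ge0 hnorm) andbT.
by rewrite (le_trans (norm_rat_act_lim _ _))// (group_norm0 hnorm) mulr0.
Qed.

Lemma rat_act_rat_act_lim (q : rat) (t : R) (g : G) : 0 <= q -> 0 <= t ->
  rat_act q (rat_act_lim t g) = rat_act_lim (ratr q * t) g.
Proof.
move=> q0 t0; have q0R : 0 <= ratr q :> R by rewrite ler0q.
apply/esym; apply: (@rat_act_lim_unique _ _ _ (ratr q * (1 + N g))).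
  exact: mulr_ge0.
move=> e e0; have Ng := group_norm_ge0 hnorm g.
have qe : 0 <= ratr q * e by rewrite mulr_ge0// ltW.
have qeN := mulr_ge0 qe Ng.
have [r [r0 tr rP]] := rat_act_lim_near t0 e0.
exists (q * r); split; first exact: mulr_ge0.
  rewrite rmorphM/= -mulrBr normrM ger0_norm//.
  have := ler_wpM2l q0R tr; lra.
rewrite -(rat_actA hdiv hnorm hsub)// -(rat_actBr hdiv hnorm hsub)//.
rewrite (norm_rat_act hdiv hnorm hsub)//.
have := ler_wpM2l q0R (rP g); lra.
Qed.

(** Two approximations: a rational [p] near [s], for which [p (t g) = (p t) g] is known, then a
    rational [r] near [p t]. *)
Lemma rat_act_limA (s t : R) (g : G) : 0 <= s -> 0 <= t ->
  rat_act_lim s (rat_act_lim t g) = rat_act_lim (s * t) g.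
Proof.
move=> s0 t0; apply/esym.
(* The scalar error is at most [e t + e], the vector error at most [e N (t g) + e N g]. *)
apply: (@rat_act_lim_unique _ _ _ (1 + t + N g + N (rat_act_lim t g))).
  exact: mulr_ge0.
move=> e e0.
have Ng := mulr_ge0 (ltW e0) (group_norm_ge0 hnorm g).
have Nt := mulr_ge0 (ltW e0) (group_norm_ge0 hnorm (rat_act_lim t g)).
have te := mulr_ge0 (ltW e0) t0.
have [p [p0 sp pP]] := rat_act_lim_near s0 e0.
have pt0 : 0 <= ratr p * t by rewrite mulr_ge0// ler0q.
have [r [r0 ptr rP]] := rat_act_lim_near pt0 e0.
exists r; split=> //.
  apply: (le_trans (ler_distD (ratr p * t) _ _)).
  rewrite -mulrBl normrM (ger0_norm t0).
  have := ler_wpM2r t0 sp; lra.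
have := group_norm_dist_triangle hnorm (rat_act_lim (ratr p * t) g).
move=> /(_ _ _)/le_trans; apply.
rewrite -{1}rat_act_rat_act_lim//.
have := pP (rat_act_lim t g); have := rP g; lra.
Qed.

(** * Extension to all reals *)

Lemma real_actE (t : R) (g : G) : 0 <= t -> real_act t g = rat_act_lim t g.
Proof. by rewrite /real_act => ->. Qed.

(** Any decomposition into nonnegative parts may be used, so the laws below need no case split on
    signs. *)
Lemma real_actB (a b : R) (g : G) : 0 <= a -> 0 <= b ->
  real_act (a - b) g = rat_act_lim a g - rat_act_lim b g.
Proof.
move=> a0 b0; rewrite /real_act subr_ge0; case: leP => [ba|/ltW ab].
  apply: (addIr (rat_act_lim b g)).
  by rewrite -rat_act_limDl ?subr_ge0// !subrK.
rewrite opprB rat_act_limNr ?subr_ge0//.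
apply: oppr_inj; rewrite opprK opprB; apply: (addIr (rat_act_lim a g)).
by rewrite -rat_act_limDl ?subr_ge0// !subrK.
Qed.

Lemma nonneg_differenceE (t : R) :
  exists a b : R, [/\ 0 <= a, 0 <= b & t = a - b].
Proof.
have [t0|/ltW t0] := leP 0 t.
  by exists t, 0; rewrite subr0.
by exists 0, (- t); rewrite oppr_ge0 opprK add0r.
Qed.

Lemma real_actDl (s t : R) (g : G) :
  real_act (s + t) g = real_act s g + real_act t g.
Proof.
have [a [b [a0 b0 ->]]] := nonneg_differenceE s.
have [c [d [c0 d0 ->]]] := nonneg_differenceE t.
rewrite addrACA -opprD !real_actB ?addr_ge0// !rat_act_limDl//.
by rewrite opprD addrACA.
Qed.

Lemma real_actDr (t : R) (g h : G) :
  real_act t (g + h) = real_act t g + real_act t h.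
Proof.
have [a [b [a0 b0 ->]]] := nonneg_differenceE t.
by rewrite !real_actB// !rat_act_limDr// opprD addrACA.
Qed.

Lemma real_actA (s t : R) (g : G) :
  real_act s (real_act t g) = real_act (s * t) g.
Proof.
have [a [b [a0 b0 ->]]] := nonneg_differenceE s.
have [c [d [c0 d0 ->]]] := nonneg_differenceE t.
have -> : (a - b) * (c - d) = (a * c + b * d) - (a * d + b * c) by ring.
rewrite !real_actB ?addr_ge0 ?mulr_ge0// !rat_act_limDl ?mulr_ge0//.
rewrite !rat_act_limDr// !rat_act_limNr// !rat_act_limA//.
rewrite !opprD opprK [in RHS]addrACA; congr (_ + _); exact: addrC.
Qed.

Lemma real_act1 (g : G) : real_act (1 : R) g = g.
Proof.
rewrite real_actE// -(rmorph1 (@ratr R)) rat_act_lim_ratr//.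
exact: (rat_act1 hdiv hnorm hsub).
Qed.

(** * Joint continuity *)

Lemma norm_real_act (t : R) (g : G) : N (real_act t g) <= `|t| * N g.
Proof.
rewrite /real_act; case: (leP 0 t) => [t0|/ltW t0].
  by rewrite ger0_norm// norm_rat_act_lim.
rewrite ler0_norm// -(group_normN hnorm g).
by rewrite norm_rat_act_lim// oppr_ge0.
Qed.

(** Split the difference as [s (g - h) + (s - t) h] and use [N h <= N g + N (g - h)], so that only
    the base point and distances to it remain. *)
Lemma real_act_dist (s t : R) (g h : G) :
  N (real_act s g - real_act t h) <=
    `|s| * N (g - h) + `|s - t| * (N g + N (g - h)).
Proof.
have -> : real_act s g - real_act t h =
    real_act s (g - h) + real_act (s - t) h.
  apply: (addIr (real_act t h)).
  by rewrite subrK -addrA -real_actDl subrK -real_actDr subrK.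
apply: (le_trans (group_normD hnorm _ _)); rewrite lerD ?norm_real_act//.
apply: (le_trans (norm_real_act _ _)); apply: ler_wpM2l => //.
have := group_normB hnorm g (g - h); by rewrite subKr.
Qed.

Lemma real_act_continuous :
  continuous (fun z : R^o * G => real_act (z.1 : R) z.2).
Proof.
move=> [s g]/=; rewrite /continuous_at/= (htop (real_act (s : R) g)).
move=> A [e /= e0 eA].
have Ng := group_norm_ge0 hnorm g.
have K0 : 0 < `|s : R| + N g + 1 by rewrite ltr_wpDl// addr_ge0.
(* The cap [1] gives [N (g - h) <= 1], so the distance bound is at most
   [d (|s| + N g + 1) <= e / 2]. *)
pose d := Num.min 1 (e / 2 / (`|s : R| + N g + 1)).
have d0 : 0 < d by rewrite lt_min ltr01 !divr_gt0.
have d1 : d <= 1 by rewrite ge_min lexx.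
have de : d * (`|s : R| + N g + 1) < e.
  apply: (@le_lt_trans _ _ (e / 2)); last by lra.
  by rewrite -ler_pdivlMr// ge_min lexx orbT.
exists (ball (s : R) d, ball_ N g d).
  by split; [exact: nbhsx_ballx|exact: nbhs_norm_ball].
move=> [t h] [/= st gh]; apply: eA.
apply: le_lt_trans (real_act_dist _ _ _ _) _.
have sg : `|s : R| * N (g - h) <= `|s : R| * d by rewrite ler_wpM2l// ltW.
have : `|(s : R) - t| * (N g + N (g - h)) <= d * (N g + 1).
  apply: ler_pM => //; rewrite ?addr_ge0 ?(group_norm_ge0 hnorm)//.
    exact: ltW.
  by rewrite lerD2l (le_trans (ltW gh)).
lra.
Qed.

Lemma real_act_tvs_action : tvs_action (@real_act R G).
Proof.
split.
- exact: real_actA.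
- exact: real_act1.
- exact: real_actDr.
- by move=> g s t; exact: real_actDl.
- exact: real_act_continuous.
Qed.

End RealAction.

Theorem proposition5p1 (R : realType) (G : topologicalZmodType) (N : G -> R)
    (hdiv : divisible_group G)
    (hnorm : group_norm N)
    (hsub : sublinear_norm N)
    (htop : norm_generates_topology N)
    (hcomplete : norm_complete N) :
  [/\ forall (t : R) (g : G), 0 <= t ->
        (fun q : rat => rat_act q g) @ near_Qplus t --> real_act t g,
      forall (t : R) (g : G), 0 <= t -> real_act (- t) g = real_act t (- g),
      tvs_action (@real_act R G)
    & forall g : G,
        {within [set t : R | 0 <= t], continuous (fun t : R => real_act t g)} /\
        forall s t : R, 0 <= s -> 0 <= t ->
          real_act (s + t) g = real_act s g + real_act t g].
Proof.
have cvg := rat_act_lim_cvg hdiv hnorm hsub htop hcomplete.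
have tvs := real_act_tvs_action hdiv hnorm hsub htop hcomplete.
split=> //.
- by move=> t g t0; rewrite real_actE//; exact: cvg.
(* At [t = 0] the scalar [- t] falls in the nonnegative branch, and both sides are [0]; for [t > 0]
   the definition applies directly. *)
- move=> t g; rewrite le_eqVlt => /predU1P[<-|t0].
    rewrite oppr0 !real_actE//.
    by rewrite !(rat_act_lim0 hdiv hnorm hsub htop hcomplete).
  by rewrite /real_act oppr_ge0 leNgt t0 (ltW t0) opprK.
- move=> g; split; last by move=> s t _ _; exact: (tvs_actDl tvs).
  (* Continuity holds on the whole line, by composing the joint action with [t |-> (t, g)]. *)
  apply: continuous_subspaceT => t.
  apply: (@continuous_comp _ _ _ (fun t : R => (t : R^o, g))
    (fun z : R^o * G => real_act (z.1 : R) z.2)); last first.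
    exact: (tvs_act_continuous tvs).
  refine (@cvg_pair R R^o G (nbhs t) (nbhs (t : R^o)) (nbhs g)
    _ _ _ id (fun=> g) _ _); [exact: cvg_id|exact: cvg_cst].
Qed.
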